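(* Let $d\ge 1$ and let $p_1,\dots,p_d\ge 2$ be integers. Then the wreath product of cyclic schemes $\chi=C_{p_1}\wr C_{p_2}\wr\cdots\wr C_{p_d}$ is triply-regular.
   Context: The cyclic scheme $C_n$ of order $n$ is the association scheme on $\{x_0,\dots,x_{n-1}\}$ with relations $R_j=\{(x_a,x_{a+j})\}$, $0\le j\le n-1$, subscripts modulo $n$. The wreath product $\chi\wr\psi$ of association schemes $\chi=(X,\{R_k\}_{0\le k\le d})$ and $\psi=(Y,\{S_k\}_{0\le k\le e})$ is the scheme on $X\times Y$ with relations $W_0$ the diagonal, $W_k=\{((x_1,y),(x_2,y))\mid (x_1,x_2)\in R_k,\ y\in Y\}$ for $1\le k\le d$, and $W_k=\{((x_1,y_1),(x_2,y_2))\mid x_1,x_2\in X,\ (y_1,y_2)\in S_{k-d}\}$ for $d+1\le k\le d+e$. Accordingly $C_{p_1}\wr\cdots\wr C_{p_d}$ has vertex set $X=X_1\times\cdots\times X_d$ with $X_i=\{x_{i,0},\dots,x_{i,p_i-1}\}$, and its relations are the diagonal $R_0$ and, for $1\le i\le d$ and $1\le\alpha\le p_i-1$, the relation $R_{(i,\alpha)}$ consisting of all pairs $(x,y)$ such that $x$ and $y$ have the same $j$-th coordinate for every $j>i$, and the $i$-th coordinates are $x_{i,a}$ and $x_{i,a+\alpha}$ (second subscript modulo $p_i$) for some $a$; there is no condition on coordinates $j<i$. An association scheme $(X,\{R_i\})$ is triply-regular if for all $x,y,z\in X$ and all relation indices $i,j,h$, the number $|R_i(x)\cap R_j(y)\cap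 R_h(z)|$ depends only on $i,j,h,l,m,n$, where $(x,y)\in R_l$, $(x,z)\in R_m$ and $(y,z)\in R_n$. Here $R_i(x)=\{w\in X\mid (x,w)\in R_i\}$. *)

(* Defs.v *)
From mathcomp Require Import all_boot all_algebra.

Set Implicit Arguments.
Unset Strict Implicit.
Unset Printing Implicit Defensive.

Import GRing.Theory.

(* Association schemes, not necessarily symmetric (the cyclic schemes of order
   greater than 2 are not). *)
Record assoc_scheme := AssocScheme {
  vertex : finType;
  nclass : nat;
  srel : 'I_nclass.+1 -> rel vertex;
  srel_neq0 : forall i, exists x y, srel i x y;
  srel_diag : forall x y, srel ord0 x y = (x == y);
  srel_partition : forall x y, exists! i, srel i x y;
  srel_transpose : forall i, exists i', forall x y, srel i' x y = srel i y x;
  srel_intersection : forall i j k, exists p, forall x y, srel k x y ->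
    #|[set z | srel i x z && srel j z y]| = p
}.

Definition snbhd (S : assoc_scheme) (i : 'I_(nclass S).+1) (x : vertex S) :
  {set vertex S} := [set w | srel i x w].

Definition triply_regular (S : assoc_scheme) : Prop :=
  forall i j h l m n : 'I_(nclass S).+1, exists t : nat,
  forall x y z : vertex S, srel l x y -> srel m x z -> srel n y z ->
    #|snbhd i x :&: snbhd j y :&: snbhd h z| = t.

Section Cyclic.
Variable n : nat.

(* For n > 0 the type 'I_n.-1.+1 is 'I_n, with addition modulo n. *)
Definition cyclic_rel (j : 'I_n.-1.+1) : rel 'I_n.-1.+1 :=
  fun x y => (y == x + j)%R.

Lemma cyclic_relE j x y : cyclic_rel j x y = (j == (y - x)%R).
Proof. by rewrite /cyclic_rel [RHS]eq_sym subr_eq addrC. Qed.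

Lemma cyclic_neq0 j : exists x y, cyclic_rel j x y.
Proof. by exists 0%R, j; rewrite /cyclic_rel add0r. Qed.

Lemma cyclic_diag x y : cyclic_rel ord0 x y = (x == y).
Proof. by rewrite cyclic_relE eq_sym subr_eq0 eq_sym. Qed.

Lemma cyclic_partition x y : exists! j, cyclic_rel j x y.
Proof.
exists (y - x)%R; split; first by rewrite cyclic_relE.
by move=> j; rewrite cyclic_relE => /eqP.
Qed.

Lemma cyclic_transpose j :
  exists j', forall x y, cyclic_rel j' x y = cyclic_rel j y x.
Proof.
by exists (- j)%R => x y; rewrite !cyclic_relE eqr_oppLR opprB.
Qed.

Lemma cyclic_intersection i j k : exists p, forall x y, cyclic_rel k x y ->
  #|[set z | cyclic_rel i x z && cyclic_rel j z y]| = p.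
Proof.
exists (k == i + j)%R => x y; rewrite cyclic_relE => /eqP kE.
have -> : [set z | cyclic_rel i x z && cyclic_rel j z y] =
          if (k == i + j)%R then [set x + i]%R else set0.
  apply/setP => z; rewrite inE {1}/cyclic_rel.
  have [->|ne] /= := eqVneq z; last by case: ifP; rewrite !inE ?(negPf ne).
  rewrite cyclic_relE opprD addrA -kE eq_sym subr_eq addrC.
  by case: ifP; rewrite !inE ?eqxx.
by case: ifP; rewrite ?cards1 ?cards0.
Qed.

Definition cyclic_scheme : assoc_scheme :=
  AssocScheme cyclic_neq0 cyclic_diag cyclic_partition cyclic_transpose
    cyclic_intersection.

End Cyclic.

Section SchemeTheory.
Variable S : assoc_scheme.
Implicit Types (i j : 'I_(nclass S).+1) (x y : vertex S).

Lemma srel_uniq i j x y : srel i x y -> srel j x y -> i = j.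
Proof.
by move=> ri rj; have [k [_ kU]] := srel_partition x y; rewrite -(kU i) ?(kU j).
Qed.

Lemma srel_refl i x : srel i x x = (i == ord0).
Proof.
have r0 : srel ord0 x x by rewrite srel_diag.
by apply/idP/eqP => [/srel_uniq/(_ r0)|->].
Qed.

Lemma out_valency i : exists q, forall x, #|[set z | srel i x z]| = q.
Proof.
have [i' i'E] := srel_transpose i; have [q qE] := srel_intersection i i' ord0.
exists q => x; rewrite -(qE x x) ?srel_diag //.
by apply: eq_card => z; rewrite !inE i'E andbb.
Qed.

Lemma in_valency i : exists q, forall x, #|[set z | srel i z x]| = q.
Proof.
have [i' i'E] := srel_transpose i; have [q qE] := out_valency i'.
by exists q => x; rewrite -(qE x); apply: eq_card => z; rewrite !inE i'E.
Qed.

End SchemeTheory.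

Section Wreath.
Variables A B : assoc_scheme.
Local Notation d := (nclass A).
Local Notation e := (nclass B).
Local Notation V := (vertex A * vertex B)%type.

(* The case k = 0 of the first branch is the diagonal, by [srel_diag]. *)
Definition wreath_rel (k : 'I_(d + e).+1) : rel V := fun u v =>
  if k <= d then srel (inord k : 'I_d.+1) u.1 v.1 && (u.2 == v.2)
  else srel (inord (k - d) : 'I_e.+1) u.2 v.2.

Lemma wreath_relE k u v : wreath_rel k u v =
  ((d < k) || srel (inord k : 'I_d.+1) u.1 v.1) &&
  srel (inord (k - d) : 'I_e.+1) u.2 v.2.
Proof.
rewrite /wreath_rel; case: leqP => //= kd; rewrite -srel_diag.
have/eqP-> : k - d == 0 by rewrite subn_eq0.
by congr (_ && srel _ _ _); apply: val_inj; rewrite /= inordK.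
Qed.

Definition wreath_inl (i : 'I_d.+1) : 'I_(d + e).+1 := inord i.
Definition wreath_inr (j : 'I_e.+1) : 'I_(d + e).+1 := inord (d + j).

Lemma wreath_rel_inl i u v :
  wreath_rel (wreath_inl i) u v = srel i u.1 v.1 && (u.2 == v.2).
Proof.
have id : i <= d by rewrite -ltnS.
by rewrite /wreath_rel inordK ?id ?inord_val // ltnS (leq_trans id) ?leq_addr.
Qed.

Lemma wreath_rel_inr j u v :
  j != ord0 -> wreath_rel (wreath_inr j) u v = srel j u.2 v.2.
Proof.
rewrite -val_eqE /= -lt0n => j_gt0; rewrite /wreath_rel inordK.
  by rewrite leqNgt -[X in X < _]addn0 ltn_add2l j_gt0 addKn inord_val.
by rewrite ltnS leq_add2l -ltnS.
Qed.

Variant wreath_index_spec : 'I_(d + e).+1 -> Prop :=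
  | WreathInl i : wreath_index_spec (wreath_inl i)
  | WreathInr j of j != ord0 : wreath_index_spec (wreath_inr j).

Lemma wreath_indexP k : wreath_index_spec k.
Proof.
have [kd|kd] := leqP k d.
  have -> : k = wreath_inl (inord k).
    by apply: val_inj; rewrite /= !inordK.
  exact: WreathInl.
have ke : k - d < e.+1 by rewrite ltnS leq_subLR -ltnS.
have -> : k = wreath_inr (inord (k - d)).
  by apply: val_inj; rewrite /wreath_inr /= (inordK ke) subnKC 1?ltnW // inordK.
by apply: WreathInr; rewrite -val_eqE /= inordK // -lt0n subn_gt0.
Qed.

Lemma wreath_neq0 k : exists u v, wreath_rel k u v.
Proof.
have [x [x' rx]] := srel_neq0 (inord k : 'I_d.+1).
have [y [y' ry]] := srel_neq0 (inord (k - d) : 'I_e.+1).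
by exists (x, y), (x', y'); rewrite wreath_relE /= rx ry orbT.
Qed.

Lemma wreath_diag u v : wreath_rel ord0 u v = (u == v).
Proof.
have -> : ord0 = wreath_inl ord0 by apply: val_inj; rewrite /= inordK.
by rewrite wreath_rel_inl srel_diag.
Qed.

Lemma wreath_partition u v : exists! k, wreath_rel k u v.
Proof.
have [i [ri iU]] := srel_partition u.1 v.1.
have [j [rj jU]] := srel_partition u.2 v.2.
have [j0|jN0] := eqVneq j ord0.
- have eq2 : u.2 = v.2 by apply/eqP; rewrite -srel_diag -j0.
  exists (wreath_inl i); split; first by rewrite wreath_rel_inl ri eq2 eqxx.
  move=> k; case: (wreath_indexP k) => [i'|j' j'N0].
    by rewrite wreath_rel_inl => /andP[/iU->].
  by rewrite wreath_rel_inr // eq2 srel_refl (negPf j'N0).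
- exists (wreath_inr j); split; first by rewrite wreath_rel_inr.
  move=> k; case: (wreath_indexP k) => [i'|j' j'N0].
    rewrite wreath_rel_inl -srel_diag => /andP[_ /jU jE].
    by rewrite jE eqxx in jN0.
  by rewrite wreath_rel_inr // => /jU->.
Qed.

Lemma wreath_transpose k :
  exists k', forall u v, wreath_rel k' u v = wreath_rel k v u.
Proof.
case: (wreath_indexP k) => [i|j jN0].
  have [i' i'E] := srel_transpose i; exists (wreath_inl i') => u v.
  by rewrite !wreath_rel_inl i'E eq_sym.
have [j' j'E] := srel_transpose j; exists (wreath_inr j') => u v.
rewrite !wreath_rel_inr ?j'E //; apply: contra_neq jN0 => j'0.
have [y _] := srel_neq0 j; apply: (@srel_uniq _ _ _ y y).
  by rewrite -j'E j'0 srel_diag.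
by rewrite srel_diag.
Qed.

Lemma wreath_intersection i j k : exists p, forall u v, wreath_rel k u v ->
  #|[set w | wreath_rel i u w && wreath_rel j w v]| = p.
Proof.
case: (wreath_indexP i) => {i} [i|i iN0];
  case: (wreath_indexP j) => {j} [j|j jN0].
- case: (wreath_indexP k) => {k} [k|k kN0].
    have [p pE] := srel_intersection i j k; exists p => -[x1 y1] [x2 y2].
    rewrite wreath_rel_inl => /= /andP[r /eqP <-].
    rewrite -(pE _ _ r) -[RHS]muln1 -(cards1 y1) -cardsX.
    apply: eq_card => -[x y]; rewrite !inE !wreath_rel_inl /= (eq_sym y1).
    by rewrite andbACA andbb.
  exists 0 => -[x1 y1] [x2 y2]; rewrite wreath_rel_inr //= => r.
  apply: eq_card0 => -[x y]; rewrite !inE !wreath_rel_inl /=.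
  apply/negbTE/negP => /andP[/andP[_ /eqP y1E] /andP[_ /eqP yE]].
  by move: r; rewrite y1E yE srel_refl (negPf kN0).
- have [q qE] := out_valency i.
  exists (if k == wreath_inr j then q else 0) => -[x1 y1] [x2 y2] r.
  have jE : srel j y1 y2 = (k == wreath_inr j).
    apply/idP/eqP => [rj|kE]; last by move: r; rewrite kE wreath_rel_inr.
    have [m [_ mU]] := wreath_partition (x1, y1) (x2, y2).
    by rewrite -(mU k) // -(mU (wreath_inr j)) // wreath_rel_inr.
  rewrite -jE; case: ifP => rj; last first.
    apply: eq_card0 => -[x y]; rewrite !inE wreath_rel_inl wreath_rel_inr //=.
    by apply/negbTE/negP => /andP[/andP[_ /eqP <-]]; rewrite rj.
  rewrite -(qE x1) -[RHS]muln1 -(cards1 y1) -cardsX.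
  apply: eq_card => -[x y].
  rewrite !inE wreath_rel_inl wreath_rel_inr //= (eq_sym y1).
  by case: eqP => [->|]; rewrite ?rj ?andbT ?andbF.
- have [q qE] := in_valency j.
  exists (if k == wreath_inr i then q else 0) => -[x1 y1] [x2 y2] r.
  have iE : srel i y1 y2 = (k == wreath_inr i).
    apply/idP/eqP => [ri|kE]; last by move: r; rewrite kE wreath_rel_inr.
    have [m [_ mU]] := wreath_partition (x1, y1) (x2, y2).
    by rewrite -(mU k) // -(mU (wreath_inr i)) // wreath_rel_inr.
  rewrite -iE; case: ifP => ri; last first.
    apply: eq_card0 => -[x y]; rewrite !inE wreath_rel_inl wreath_rel_inr //=.
    by apply/negbTE/negP => /andP[+ /andP[_ /eqP yE]]; rewrite yE ri.
  rewrite -(qE x2) -[RHS]muln1 -(cards1 y2) -cardsX.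
  apply: eq_card => -[x y]; rewrite !inE wreath_rel_inl wreath_rel_inr //=.
  by case: eqP => [->|]; rewrite ?ri ?andbT ?andbF.
- have [p pE] := srel_intersection i j (inord (k - d) : 'I_e.+1).
  exists (#|vertex A| * p) => -[x1 y1] [x2 y2].
  rewrite wreath_relE => /andP[_ r].
  rewrite -(pE _ _ r) -cardsT -cardsX; apply: eq_card => -[x y].
  by rewrite !inE !wreath_rel_inr.
Qed.

Definition wreath : assoc_scheme :=
  AssocScheme wreath_neq0 wreath_diag wreath_partition wreath_transpose
    wreath_intersection.

End Wreath.

(* The wreath product of the cyclic schemes of orders p 1, ..., p d, for d > 0;
   the value at d = 0 is a placeholder. *)
Fixpoint wreath_cyclic (p : nat -> nat) (d : nat) : assoc_scheme :=
  match d with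
  | 0 => cyclic_scheme 1
  | 1 => cyclic_scheme (p 1)
  | d'.+1 => wreath (wreath_cyclic p d') (cyclic_scheme (p d))
  end.

(* Main.v *)
Require Import Defs.
From mathcomp Require Import all_boot.
From mathcomp Require Import ssralg zmodp.

(** Triple regularity is preserved by wreath products, and cyclic schemes have
it, so the theorem follows by induction on the number of factors.

In a cyclic scheme a vertex [w] is determined by [x] and by the relation of
[(x, w)], and whether [w] also lies in the other two neighbourhoods can be read
off from the differences [y - x] and [z - x]; every triple count is 0 or 1
([cyclic_triply_regular]).

For [wreath A B], [wreath_relE] writes each relation as a condition on the first
coordinates times a condition on the second ones, where the first condition is
either a relation of [A] or no condition at all. A triple count is therefore a
triple count in [B] times a count in [A] in which some of the three constraints
may be absent. The latter depends only on the relations of [A] between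
the points that are still constrained ([triply_regular_partial]). If the count
in [B] is nonzero, two points that both constrain the first coordinate have
equal second coordinates, so that their relation in the wreath product does
record their relation in [A] ([wreath_same_fibre]); if the count in [B] is zero,
the value of the other factor is irrelevant. *)

Set Implicit Arguments.
Unset Strict Implicit.
Unset Printing Implicit Defensive.

Import GRing.Theory.

Lemma cyclic_triply_regular n : triply_regular (cyclic_scheme n).
Proof.
move=> i j h l m k.
exists ((j == i - l) && (h == i - m))%R => x y z /=.
rewrite !cyclic_relE => /eqP -> /eqP -> _.
have relE (u v : 'I_n.-1.+1) : (u == i - (v - x))%R = cyclic_rel u v (x + i)%R.
  by rewrite cyclic_relE opprB addrA (addrC i).
rewrite !relE; set b := _ && _.
have -> : snbhd i x :&: snbhd j y :&: snbhd h z =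
    if b then [set (x + i)%R] else set0 :> {set 'I_n.-1.+1}.
  apply/setP => w; rewrite !inE /= {1}/cyclic_rel.
  by case: eqP => [->|/eqP/negPf ne] /=; rewrite -?/b; case: b;
    rewrite !inE ?eqxx ?ne.
by case: b; rewrite ?cards1 ?cards0.
Qed.

(** The flags [a], [b], [c] switch off the constraint imposed by [x], [y], [z].
Unless all three are off, a point that is switched off can be replaced by one
that is not, with its index: repeating a constraint does not change the count,
and the relation of a point with itself is the diagonal, so triple regularity
applies again. *)
Lemma triply_regular_partial (S : assoc_scheme) (a b c : bool)
    (i j h l m n : 'I_(nclass S).+1) : triply_regular S ->
  exists t, forall x y z : vertex S,
    [|| a, b | srel l x y] -> [|| a, c | srel m x z] ->
    [|| b, c | srel n y z] ->
    #|[set w | [&& a || srel i x w, b || srel j y w & c || srel h z w]]| = t.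
Proof.
move=> trS; have diag (x : vertex S) : srel ord0 x x by rewrite srel_diag.
case: a b c => [] [] [] /=.
- by exists #|vertex S| => x y z _ _ _; apply: eq_card => w; rewrite !inE.
- have [t tE] := trS h h h ord0 ord0 ord0; exists t => x y z _ _ _.
  by rewrite -(tE z z z) //; apply: eq_card => w; rewrite !inE !andbb.
- have [t tE] := trS j j j ord0 ord0 ord0; exists t => x y z _ _ _.
  by rewrite -(tE y y y) //; apply: eq_card => w; rewrite !inE andbT !andbb.
- have [t tE] := trS j j h ord0 n n; exists t => x y z _ _ yz.
  by rewrite -(tE y y z) //; apply: eq_card => w; rewrite !inE andbb.
- have [t tE] := trS i i i ord0 ord0 ord0; exists t => x y z _ _ _.
  by rewrite -(tE x x x) //; apply: eq_card => w; rewrite !inE andbT !andbb.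
- have [t tE] := trS i i h ord0 m m; exists t => x y z _ xz _.
  by rewrite -(tE x x z) //; apply: eq_card => w; rewrite !inE andbb.
- have [t tE] := trS i i j ord0 l l; exists t => x y z xy _ _.
  by rewrite -(tE x x y) //; apply: eq_card => w; rewrite !inE andbT andbb.
- have [t tE] := trS i j h l m n; exists t => x y z xy xz yz.
  by rewrite -(tE x y z) //; apply: eq_card => w; rewrite !inE andbA.
Qed.

(** If neither index exceeds the class number of [A], both hypotheses on [w2]
are equalities; hence [u] and [v] lie in the same copy of [A], and their
relation is one of those inherited from [A]. *)
Lemma wreath_same_fibre (A B : assoc_scheme) (u v : vertex (wreath A B))
    (w2 : vertex B) (i j l : 'I_(nclass A + nclass B).+1) :
  srel (inord (i - nclass A) : 'I_(nclass B).+1) u.2 w2 ->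
  srel (inord (j - nclass A) : 'I_(nclass B).+1) v.2 w2 ->
  wreath_rel l u v ->
  [|| nclass A < i, nclass A < j |
      srel (inord l : 'I_(nclass A).+1) u.1 v.1].
Proof.
have eq_of (k : 'I_(nclass A + nclass B).+1) (y y' : vertex B) :
    k <= nclass A -> srel (inord (k - nclass A) : 'I_(nclass B).+1) y y' ->
    y = y'.
  rewrite -subn_eq0 => /eqP ->.
  have -> : inord 0 = ord0 :> 'I_(nclass B).+1.
    by apply: val_inj; rewrite /= inordK.
  by rewrite srel_diag => /eqP.
case: (ltnP (nclass A) i) => //= iA; case: (ltnP (nclass A) j) => //= jA.
move=> /(eq_of _ _ _ iA) u2 /(eq_of _ _ _ jA) v2.
rewrite wreath_relE u2 v2 srel_refl => /andP[/orP[lA|//]].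
have lB : l - nclass A < (nclass B).+1 by rewrite ltnS leq_subLR -ltnS.
by rewrite -val_eqE /= inordK // subn_eq0 leqNgt lA.
Qed.

Lemma wreath_triply_regular (A B : assoc_scheme) :
  triply_regular A -> triply_regular B -> triply_regular (wreath A B).
Proof.
move=> trA trB i j h l m n /=; set d := nclass A.
pose pA (k : 'I_(d + nclass B).+1) : 'I_d.+1 := inord k.
pose pB (k : 'I_(d + nclass B).+1) : 'I_(nclass B).+1 := inord (k - d).
have [tA tAE] := triply_regular_partial (d < i) (d < j) (d < h)
  (pA i) (pA j) (pA h) (pA l) (pA m) (pA n) trA.
have [tB tBE] := trB (pB i) (pB j) (pB h) (pB l) (pB m) (pB n).
exists (tA * tB) => x y z xy xz yz.
have relB k u v : @wreath_rel A B k u v -> srel (pB k) u.2 v.2.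
  by rewrite wreath_relE => /andP[].
rewrite -(tBE _ _ _ (relB _ _ _ xy) (relB _ _ _ xz) (relB _ _ _ yz)).
set sB := snbhd (pB i) x.2 :&: snbhd (pB j) y.2 :&: snbhd (pB h) z.2.
set sA := [set w | [&& (d < i) || srel (pA i) x.1 w,
  (d < j) || srel (pA j) y.1 w & (d < h) || srel (pA h) z.1 w]].
transitivity (#|sA| * #|sB|).
  rewrite -cardsX; apply: eq_card => -[w1 w2].
  rewrite !inE /= !wreath_relE -/d -!/(pA _) -!/(pB _) /=.
  by rewrite [X in X && _ = _]andbACA [LHS]andbACA -[X in X && _ = _]andbA.
have [->|[w2]] := set_0Vmem sB; first by rewrite cards0 !muln0.
rewrite !inE => /andP[/andP[xw yw] zw]; congr (_ * _).
by apply: tAE; [apply: wreath_same_fibre xw yw xy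
  | apply: wreath_same_fibre xw zw xz | apply: wreath_same_fibre yw zw yz].
Qed.

Theorem theorem3p4 (d : nat) (p : nat -> nat)
  (d_ge1 : 1 <= d) (p_ge2 : forall i, 1 <= i <= d -> 2 <= p i) :
  triply_regular (wreath_cyclic p d).
Proof.
case: d d_ge1 {p_ge2} => // d _; elim: d => [|d IHd].
  exact: cyclic_triply_regular.
apply: (@wreath_triply_regular (wreath_cyclic p d.+1)) IHd _.
exact: cyclic_triply_regular.
Qed.
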